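(* Suppose $Y$ is a compact Hausdorff space, and $K$ is an $\eta$-space. Then $Y\times K$ (with the product topology) is an $\eta$-space.
   Context: For a compact Hausdorff space $X$, $C(X)$ denotes the algebra of complex-valued continuous functions on $X$. A map $T$ on $C(X)$ is additive if $T(f+g)=T(f)+T(g)$ for all $f,g$; it is a multiplication if there is $a\in C(X)$ with $T(f)=af$ for all $f\in C(X)$; it is a local multiplication if for each $f\in C(X)$ there is $a_f\in C(X)$ with $T(f)=a_f f$. A compact Hausdorff space $X$ is an $\eta$-space if every additive local multiplication on $C(X)$ is a multiplication. *)

(* Defs.v *)
From HB Require Import structures.
From mathcomp Require Import all_boot all_order all_algebra.
From mathcomp Require Import all_classical all_reals all_analysis.
From mathcomp Require Import complex.
Set Implicit Arguments.
Unset Strict Implicit.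
Unset Printing Implicit Defensive.
Import Order.TTheory GRing.Theory Num.Theory numFieldNormedType.Exports.
Local Open Scope classical_set_scope.
Local Open Scope ring_scope.
Local Open Scope complex_scope.

(* MathComp-Analysis topologizes every numFieldType by its norm, but only
   through the regular module K^o does this reach the concrete type R[i]. *)
HB.instance Definition _ (R : realType) := NormedModule.copy R[i] R[i]^o.

(* X is an arbitrary, possibly empty, topological space, whence a ring that is
   not required to be nontrivial. *)
Definition Cfun (R : realType) (X : topologicalType) : Type :=
  continuousType X R[i].

HB.instance Definition _ (R : realType) (X : topologicalType) :=
  Choice.on (Cfun R X).

Section CfunRing.
Context {R : realType} {X : topologicalType}.
Implicit Types f g h : Cfun R X.

Definition Cfun_eval f : X -> R[i] := Continuous.sort f.
Local Coercion Cfun_eval : Cfun >-> Funclass.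

Definition Cfun_of (u : X -> R[i]) (cu : continuous u) : Cfun R X :=
  (mkcts cu : continuousType X R[i]).

Let Cfun_ext f g : (forall x, f x = g x) -> f = g.
Proof. by move=> fg; apply/continuousEP. Qed.

Let Cfun_cts f : continuous (f : X -> R[i]).
Proof. exact: (@cts_fun _ _ f). Qed.

Let cst_cts (c : R[i]) : continuous (fun _ : X => c).
Proof. by move=> x; exact: cvg_cst. Qed.

Let add_cts f g : continuous (fun x => f x + g x).
Proof. by move=> x; apply: (@cvgD R[i] R[i]); exact: Cfun_cts. Qed.

Let opp_cts f : continuous (fun x => - f x).
Proof. by move=> x; apply: (@cvgN R[i] R[i]); exact: Cfun_cts. Qed.

Let mul_cts f g : continuous (fun x => f x * g x).
Proof. by move=> x; apply: (@cvgM R[i]); exact: Cfun_cts. Qed.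

Definition Cfun_zero : Cfun R X := Cfun_of (@cst_cts 0).
Definition Cfun_one : Cfun R X := Cfun_of (@cst_cts 1).
Definition Cfun_add f g : Cfun R X := Cfun_of (@add_cts f g).
Definition Cfun_opp f : Cfun R X := Cfun_of (@opp_cts f).
Definition Cfun_mul f g : Cfun R X := Cfun_of (@mul_cts f g).

Let addA : associative Cfun_add.
Proof. by move=> f g h; apply: Cfun_ext => x; exact: addrA. Qed.
Let addC : commutative Cfun_add.
Proof. by move=> f g; apply: Cfun_ext => x; exact: addrC. Qed.
Let add0 : left_id Cfun_zero Cfun_add.
Proof. by move=> f; apply: Cfun_ext => x; exact: add0r. Qed.
Let addN : left_inverse Cfun_zero Cfun_opp Cfun_add.
Proof. by move=> f; apply: Cfun_ext => x; exact: addNr. Qed.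

HB.instance Definition _ :=
  GRing.isZmodule.Build (Cfun R X) addA addC add0 addN.

Let mulA : associative Cfun_mul.
Proof. by move=> f g h; apply: Cfun_ext => x; exact: mulrA. Qed.
Let mulC : commutative Cfun_mul.
Proof. by move=> f g; apply: Cfun_ext => x; exact: mulrC. Qed.
Let mul1 : left_id Cfun_one Cfun_mul.
Proof. by move=> f; apply: Cfun_ext => x; exact: mul1r. Qed.
Let mulD : left_distributive Cfun_mul Cfun_add.
Proof. by move=> f g h; apply: Cfun_ext => x; exact: mulrDl. Qed.

HB.instance Definition _ :=
  GRing.Zmodule_isComPzRing.Build (Cfun R X) mulA mulC mul1 mulD.

End CfunRing.

Section EtaSpace.
Context {R : realType}.

Definition is_additive (X : topologicalType) (T : Cfun R X -> Cfun R X) : Prop :=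
  forall f g, T (f + g) = T f + T g.

Definition is_multiplication (X : topologicalType)
    (T : Cfun R X -> Cfun R X) : Prop :=
  exists a, forall f, T f = a * f.

Definition is_local_multiplication (X : topologicalType)
    (T : Cfun R X -> Cfun R X) : Prop :=
  forall f, exists a, T f = a * f.

Definition compact_hausdorff (X : topologicalType) : Prop :=
  compact [set: X] /\ hausdorff_space X.

End EtaSpace.

Definition eta_space (R : realType) (X : topologicalType) : Prop :=
  compact_hausdorff X /\
  forall T : Cfun R X -> Cfun R X,
    is_additive T -> is_local_multiplication T -> is_multiplication T.

(* Main.v *)
Require Import Defs.
From mathcomp Require Import all_boot all_order all_algebra.
From mathcomp Require Import all_classical all_reals all_analysis.
From mathcomp Require Import complex.

(** If a function vanishes at a point then so does its image under a local
    multiplication [T].  So, when [T] is additive, the value of [T f] at a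
    point [(y, k)] depends only on the number [f (y, k)]: there [f] may be
    replaced by [g] composed with the projection to [K], where
    [g := f (y, _)] is the slice of [f] through [y].  On functions pulled back
    from [K], reading [T] off on the slice over [y] is an additive local
    multiplication of [C(K)]; as [K] is an eta-space, it is multiplication by
    the slice of [T 1].  Hence [T f (y, k) = T 1 (y, k) * f (y, k)] everywhere,
    that is, [T f = T 1 * f]. *)

Set Implicit Arguments.
Unset Strict Implicit.
Unset Printing Implicit Defensive.
Import GRing.Theory.
Local Open Scope classical_set_scope.
Local Open Scope ring_scope.

Lemma hausdorff_setX (X Z : topologicalType) :
  hausdorff_space X -> hausdorff_space Z -> hausdorff_space (X * Z)%type.
Proof.
move=> hX hZ [x z] [x' z'] cl; congr pair.
- apply: hX => A B Ax Bx'.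
  have [[u v] /= [Au Bu]] := cl (fst @^-1` A) (fst @^-1` B)
    (@cvg_fst _ _ _ _ (nbhs_filter z) _ Ax)
    (@cvg_fst _ _ _ _ (nbhs_filter z') _ Bx').
  by exists u.
- apply: hZ => A B Az Bz'.
  have [[u v] /= [Av Bv]] := cl (snd @^-1` A) (snd @^-1` B)
    (@cvg_snd _ _ _ _ (nbhs_filter x) _ Az)
    (@cvg_snd _ _ _ _ (nbhs_filter x') _ Bz').
  by exists v.
Qed.

Lemma compact_hausdorff_setX (X Z : topologicalType) :
  compact_hausdorff X -> compact_hausdorff Z ->
  compact_hausdorff (X * Z)%type.
Proof.
move=> [cX hX] [cZ hZ]; split; last exact: hausdorff_setX.
by rewrite -setXTT; exact: compact_setX.
Qed.

Section Cfun.
Context {R : realType} {X : topologicalType}.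

Lemma Cfun_ext (f g : Cfun R X) : Cfun_eval f =1 Cfun_eval g -> f = g.
Proof. by move=> fg; exact/continuousEP. Qed.

Lemma Cfun_continuous (f : Cfun R X) : continuous (Cfun_eval f).
Proof. exact: (@cts_fun _ _ f). Qed.

(** The difference [f - g] vanishes at [x], hence so does its multiple
    [T (f - g)], which is [T f - T g] by additivity. *)
Lemma local_multiplication_eq_at (T : Cfun R X -> Cfun R X) (x : X)
    (f g : Cfun R X) :
  is_additive T -> is_local_multiplication T ->
  Cfun_eval f x = Cfun_eval g x -> Cfun_eval (T f) x = Cfun_eval (T g) x.
Proof.
move=> aT lT fgx; have [a Ta] := lT (f - g).
rewrite -[f](subrK g) aT Ta.
change (Cfun_eval a x * (Cfun_eval f x - Cfun_eval g x) + Cfun_eval (T g) x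
  = Cfun_eval (T g) x).
by rewrite fgx subrr mulr0 add0r.
Qed.

End Cfun.

Section Comp.
Context {R : realType} {X Z : topologicalType}.

Lemma Cfun_comp_continuous (f : Cfun R Z) (u : X -> Z) :
  continuous u -> continuous (Cfun_eval f \o u).
Proof.
by move=> cu x; apply: continuous_comp; [exact: cu|exact: Cfun_continuous].
Qed.

Definition Cfun_comp (u : X -> Z) (cu : continuous u) (f : Cfun R Z) :
  Cfun R X := Cfun_of (Cfun_comp_continuous (f := f) cu).

End Comp.

Section Slice.
Context {R : realType} {Y K : topologicalType}.

Lemma slice_continuous (y : Y) : continuous (fun k : K => (y, k)).
Proof. by move=> k; apply: cvg_pair => //; exact: cvg_cst. Qed.

Lemma proj_continuous : continuous (@snd Y K).
Proof. by move=> [y k]; exact: cvg_snd. Qed.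

Definition slice (y : Y) : Cfun R (Y * K)%type -> Cfun R K :=
  Cfun_comp (@slice_continuous y).

Definition pullback : Cfun R K -> Cfun R (Y * K)%type :=
  Cfun_comp proj_continuous.

Definition slice_operator
    (T : Cfun R (Y * K)%type -> Cfun R (Y * K)%type) (y : Y) :
  Cfun R K -> Cfun R K := fun g => slice y (T (pullback g)).

Lemma slice_operator_additive T y :
  is_additive T -> is_additive (slice_operator T y).
Proof.
move=> aT g h; rewrite /slice_operator.
have -> : pullback (g + h) = pullback g + pullback h by exact: Cfun_ext.
by rewrite aT; exact: Cfun_ext.
Qed.

Lemma slice_operator_local T y :
  is_local_multiplication T -> is_local_multiplication (slice_operator T y).
Proof.
move=> lT g; have [a Ta] := lT (pullback g).
by exists (slice y a); rewrite /slice_operator Ta; exact: Cfun_ext.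
Qed.

End Slice.

Theorem theorem4 (R : realType) (Y K : topologicalType)
    (hY : compact_hausdorff Y) (hK : eta_space R K) :
  eta_space R (Y * K)%type.
Proof.
have [chK etaK] := hK; split; first exact: compact_hausdorff_setX.
move=> T aT lT; exists (T 1) => f; apply: Cfun_ext => -[y k].
have [b Tyb] := etaK _ (slice_operator_additive y aT)
  (slice_operator_local y lT).
have Tpull g : Cfun_eval (T (pullback g)) (y, k)
    = Cfun_eval b k * Cfun_eval g k.
  exact: (congr1 (fun h => Cfun_eval h k) (Tyb g)).
have b1 : Cfun_eval (T 1) (y, k) = Cfun_eval b k.
  have <- : pullback 1 = 1 :> Cfun R (Y * K)%type by exact: Cfun_ext.
  by rewrite Tpull; exact: mulr1.
rewrite (local_multiplication_eq_at (g := pullback (slice y f)) aT lT) //.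
by rewrite Tpull -b1.
Qed.
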